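(* Let $k \geq 1$ be an integer and suppose $t \in [0, 1]$ satisfies $$\frac{k}{k+1} \left((t^k - t + 1)^{\frac{k+1}{k}} - t^{k + 1}\right) \geq \frac{1 - t^2}{2}.$$ Then in any election there exists a committee of $k$ candidates that is $(t^k - t + 1)$-undominated.
   Context: An election consists of a finite set $V$ of $n$ voters, a finite set $C$ of candidates, and for each voter $v$ a strict linear order $\succ_v$ on $C$. A committee is a subset $S \subseteq C$. For a candidate $a$ and committee $S$, write $a \succ_v S$ if $v$ prefers $a$ to every member of $S$, and let $\frac1n|a \succ S| = \frac1n|\{v \in V : a \succ_v S\}|$. A committee $S$ is $\alpha$-undominated if for every candidate $a \in C$, $\frac1n|a \succ S| < \alpha$. *)

(* Defs.v *)
From HB Require Import structures.
From mathcomp Require Import all_boot all_order all_algebra.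
From mathcomp Require Import all_classical all_reals all_analysis.
Set Implicit Arguments. Unset Strict Implicit. Unset Printing Implicit Defensive.
Import Order.TTheory GRing.Theory Num.Theory.
Local Open Scope ring_scope.

(* A strict linear order on C, given as a boolean relation
   ([lt a b] means "a is preferred to b"). *)
Definition strict_linear_order (C : finType) (lt : rel C) : Prop :=
  [/\ (forall a, ~~ lt a a),
      (forall a b c, lt a b -> lt b c -> lt a c) &
      (forall a b, a != b -> lt a b || lt b a)].

Definition election (V C : finType) (pref : V -> rel C) : Prop :=
  forall v, strict_linear_order (pref v).

Definition prefers_to_all (V C : finType) (pref : V -> rel C)
  (v : V) (a : C) (S : {set C}) : bool :=
  [forall b in S, pref v a b].

Definition dom_frac (R : realType) (V C : finType) (pref : V -> rel C)
  (a : C) (S : {set C}) : R :=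
  (#|[set v | prefers_to_all pref v a S]|)%:R / (#|V|)%:R.

Definition undominated (R : realType) (V C : finType) (pref : V -> rel C)
  (alpha : R) (S : {set C}) : Prop :=
  forall a : C, dom_frac R pref a S < alpha.

(* Main.v *)
Require Import Defs.
From HB Require Import structures.
From mathcomp Require Import all_boot all_order all_algebra.
From mathcomp Require Import all_classical all_reals all_analysis.
From mathcomp Require Import ring lra.
Import Order.TTheory GRing.Theory Num.Theory.
Local Open Scope ring_scope.

Set Implicit Arguments.
Unset Strict Implicit.

(* For a lottery D on C let P_v(a) be the D-weight of the candidates that v
   ranks below a. The averages over v of max(P_v(a), t) are convex in D, and
   their mean over a drawn from D is a lower Riemann sum of
   int_0^1 max(x, t) dx = (1 + t^2)/2, strictly below it. By a convex minimax
   argument some D has all these averages below (1 + t^2)/2 at once.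
   Draw a committee of k independent samples from this D. For each voter the
   D-quantile of the best sample dominates u^(1/k) with u uniform. If every
   committee were dominated by a candidate a for a fraction at least
   alpha = t^k - t + 1 of the voters, then for those voters P_v(a) is at least
   that quantile; with q = alpha^(1/k) and the bound
   max(P_v(a), t) >= q - (q - max(quantile, t))^+, averaging gives
   (1 - t^2)/2 > int_{t^k}^alpha u^(1/k) du, against the hypothesis. *)

(** * Finite strict linear orders *)

Lemma strict_linear_order_top (C : finType) (lt : rel C) (X : {set C}) (x : C) :
  strict_linear_order lt -> x \in X ->
  exists2 b, b \in X & forall c, c \in X -> c != b -> lt b c.
Proof.
move=> [irr tr tot] xX.
case: (arg_maxnP (fun b => #|[set c in X | lt b c]|) xX) => b bX bmax.
exists b => // c cX cb; have /orP[cltb|//] := tot _ _ cb.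
suff: (#|[set d in X | lt b d]| < #|[set d in X | lt c d]|)%N.
  by rewrite ltnNge; have := bmax c cX => /= ->.
apply: proper_card; apply/properP; split.
  by apply/fintype.subsetP => d; rewrite !inE => /andP[-> /(tr _ _ _ cltb)].
by exists b; rewrite !inE ?(bX : b \in X) ?cltb /= ?(negbTE (irr b)) ?andbF.
Qed.

(** The intervals from the weight strictly below [a] to that weight plus [D a] tile the range from 0
    to the total weight. The induction removes the best element, which lies below no other and so
    leaves their sums unchanged. *)
Lemma telescope_strict_linear_order (R : zmodType) (C : finType) (lt : rel C)
    (D : C -> R) (F : R -> R) :
  strict_linear_order lt ->
  \sum_a (F (\sum_(b | lt a b) D b + D a) - F (\sum_(b | lt a b) D b)) =
  F (\sum_a D a) - F 0.
Proof.
move=> ltP.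
suff H n : forall X : {set C}, #|X| = n ->
    \sum_(a in X) (F (\sum_(b in X | lt a b) D b + D a)
      - F (\sum_(b in X | lt a b) D b)) = F (\sum_(a in X) D a) - F 0.
  have := H _ [set: C] erefl.
  rewrite (eq_bigl xpredT) => [|a]; last by rewrite inE.
  rewrite [in RHS](eq_bigl xpredT) => [<-|a]; last by rewrite inE.
  apply: eq_bigr => a _.
  rewrite (eq_bigl (fun b => (b \in [set: C]) && lt a b)) // => b.
  by rewrite inE.
elim: n => [|n IHn] X cX.
  by have/cards0_eq -> := cX; rewrite !big_set0 subrr.
have [x xX] : exists x, x \in X by apply/card_gt0P; rewrite cX.
have [a aX atop] := strict_linear_order_top ltP xX.
have [irr tr _] := ltP.
rewrite (bigD1 a) //=.
have -> : \sum_(b in X | lt a b) D b = \sum_(b in X :\ a) D b.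
  apply: eq_bigl => b; rewrite !inE andbC; case bX: (b \in X); rewrite ?andbF //.
  rewrite !andbT; have [->|ba] := eqVneq b a; first exact/negbTE/irr.
  exact: atop.
have -> : \sum_(b in X) D b = \sum_(b in X :\ a) D b + D a.
  rewrite (bigD1 a) //= addrC; congr (_ + _).
  by apply: eq_bigl => b; rewrite !inE andbC.
have cXa : #|X :\ a| = n by move: cX; rewrite (cardsD1 a) aX => -[].
set Y := \sum_(b in X :\ a) D b.
rewrite -[F (Y + D a) in RHS](subrK (F Y)) -[RHS]addrA -(IHn _ cXa).
congr (_ + _).
apply: eq_big => [b|b /andP[bX ba]]; first by rewrite !inE andbC.
suff -> : \sum_(c in X | lt b c) D c = \sum_(c in X :\ a | lt b c) D c by [].
apply: eq_bigl => c; rewrite !inE; case: eqVneq => //= ->.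
rewrite aX /=; apply/negbTE/negP => ltba.
by have := tr _ _ _ ltba (atop _ bX ba); rewrite (negbTE (irr b)).
Qed.

(** * Lotteries and convex minimax *)

Definition lottery (R : realFieldType) (I : finType) (D : I -> R) : Prop :=
  (forall a, 0 <= D a) /\ \sum_a D a = 1.

Lemma lottery_mix (R : realFieldType) (I : finType) (D Q : I -> R) (e : R) :
  lottery D -> lottery Q -> 0 <= e <= 1 ->
  lottery (fun a => (1 - e) * D a + e * Q a).
Proof.
move=> [D0 D1] [Q0 Q1] /andP[e0 e1]; split => [a|].
  by rewrite addr_ge0 // mulr_ge0 // subr_ge0.
by rewrite big_split /= -!mulr_sumr D1 Q1; ring.
Qed.

Lemma sqr_pos_part_le (R : realFieldType) (x h : R) :
  (Num.max (x + h) 0) ^+ 2 <=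
  (Num.max x 0) ^+ 2 + 2 * h * Num.max x 0 + h ^+ 2.
Proof. by case: (leP x 0) => ?; case: (leP (x + h) 0) => ?; nra. Qed.

Lemma sqr_pos_part_homo (R : realFieldType) :
  {homo (fun x : R => Num.max x 0 ^+ 2) : x y / x <= y}.
Proof. by move=> x y xy /=; case: (leP x 0) => ?; case: (leP y 0) => ?; nra. Qed.

(** Stands in for compactness of the set of lotteries: a fixed decrease [e] at each point, iterated,
    would make [H] negative. *)
Lemma no_uniform_descent (R : archiRealFieldType) (T : Type) (P : T -> Prop)
    (H : T -> R) (e : R) (x0 : T) :
  0 < e -> P x0 -> (forall x, P x -> 0 <= H x) ->
  (forall x, P x -> exists2 y, P y & H y <= H x - e) -> False.
Proof.
move=> e0 P0 H0 step.
have it n : exists2 x, P x & H x <= H x0 - e *+ n.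
  elim: n => [|n [x Px Hx]]; first by exists x0; rewrite ?mulr0n ?subr0.
  have [y Py Hy] := step x Px; exists y => //.
  by rewrite mulrS; lra.
have := archi_boundP (divr_ge0 (H0 _ P0) (ltW e0)).
set n := Num.bound _; rewrite ltr_pdivrMr // mulrC mulr_natr => lt_n.
have [x /H0 ? ?] := it n; lra.
Qed.

(* Descent on the sum of squares of the excesses (g D a - c)^+: moving D
   slightly towards the lottery Q proportional to these excesses decreases it
   by a fixed amount, because Q itself gains at most c against Q. *)
Lemma convex_minimax_diag (R : archiRealFieldType) (I : finType) (i0 : I)
    (g : (I -> R) -> I -> R) (c c' : R) :
  (forall D a, lottery D -> 0 <= g D a <= 1) ->
  (forall (D Q : I -> R) (e : R) a, lottery D -> lottery Q -> 0 <= e <= 1 ->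
     g (fun b => (1 - e) * D b + e * Q b) a <= (1 - e) * g D a + e * g Q a) ->
  (forall Q, lottery Q -> \sum_a Q a * g Q a <= c) ->
  c < c' ->
  exists2 D, lottery D & forall a, g D a < c'.
Proof.
move=> g01 gconv gdiag cc'.
apply: contrapT => noD.
have big_ex D : lottery D -> exists a, c' <= g D a.
  move=> lD; apply: contrapT => na; apply: noD; exists D => // a.
  by rewrite ltNge; apply/negP => ?; apply: na; exists a.
pose m : R := #|I|%:R.
have m1 : 1 <= m by rewrite ler1n; apply/card_gt0P; exists i0.
have l0 : @lottery R I (fun a => (a == i0)%:R).
  by split=> [a|]; rewrite ?ler0n // (bigD1 i0) //= eqxx big1 ?addr0 // => a /negbTE ->.
have c0 : 0 <= c.
  apply: le_trans (gdiag _ l0); apply: sumr_ge0 => a _.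
  by rewrite mulr_ge0 ?ler0n //; have /andP[] := g01 _ a l0.
have c1 : c' <= 1.
  by have [a ca] := big_ex _ l0; have /andP[_] := g01 _ a l0; apply: le_trans.
pose d := c' - c.
have d0 : 0 < d by rewrite subr_gt0.
have d1 : d <= 1 by rewrite /d; lra.
pose H (D : I -> R) := \sum_a (Num.max (g D a - c) 0) ^+ 2.
have m0 : 0 < m by lra.
apply: (@no_uniform_descent R _ (@lottery R I) H (d ^+ 4 / m) _ _ l0).
- by rewrite divr_gt0 // exprn_gt0.
- by move=> D _; apply: sumr_ge0 => a _; rewrite sqr_ge0.
move=> D lD.
pose p a := Num.max (g D a - c) 0.
have p0 a : 0 <= p a by rewrite /p le_max lexx orbT.
have [a0 a0c] := big_ex D lD.
have pa0 : d <= p a0 by rewrite /p le_max /d lerD2r a0c.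
pose W := \sum_a p a.
have W0 : 0 < W.
  rewrite /W (bigD1 a0) //=; apply: ltr_wpDr; last exact: lt_le_trans pa0.
  by apply: sumr_ge0.
pose Q a := p a / W.
have lQ : lottery Q.
  split=> [a|]; first by rewrite divr_ge0 // ltW.
  by rewrite -mulr_suml divff // gt_eqF.
(* The decrease will be at least [2 * e * d ^+ 2 - e ^+ 2 * m]; this [e] maximises it, with value
   [d ^+ 4 / m]. *)
pose e := d ^+ 2 / m.
have e0 : 0 < e by rewrite divr_gt0 // exprn_gt0.
have e1 : e <= 1 by rewrite ler_pdivrMr //; nra.
exists (fun b => (1 - e) * D b + e * Q b).
  by apply: lottery_mix => //; rewrite ltW.
have HD : d ^+ 2 <= H D.
  rewrite /H (bigD1 a0) //=; apply: ler_wpDr.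
    by apply: sumr_ge0 => a _; rewrite sqr_ge0.
  by rewrite ler_pXn2r // nnegrE ?p0 // ltW.
have pq : \sum_a p a * (g Q a - c) <= 0.
  have -> : \sum_a p a * (g Q a - c) = W * (\sum_a Q a * g Q a - c).
    have -> : \sum_a Q a * g Q a - c = \sum_a Q a * (g Q a - c).
      under [RHS]eq_bigr do rewrite mulrBr.
      by rewrite sumrB -mulr_suml lQ.2 mul1r.
    rewrite mulr_sumr; apply: eq_bigr => a _.
    by rewrite mulrA /Q mulrCA divff ?mulr1 // gt_eqF.
  by rewrite pmulr_rle0 // subr_le0 gdiag.
have pd : \sum_a p a * (g D a - c) = H D.
  by apply: eq_bigr => a _; rewrite /p; case: leP => ?; ring.
(* By convexity the excess at [a] moves by at most [e * (g Q a - g D a)], whose square is at most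
   [e ^+ 2] since [g] has values in [0, 1]. *)
apply: (@le_trans _ _ (\sum_a (p a ^+ 2
    + 2 * e * (p a * (g Q a - c) - p a * (g D a - c)) + e ^+ 2))).
  apply: ler_sum => a _.
  have /andP[? ?] := g01 Q a lQ; have /andP[? ?] := g01 D a lD.
  have := gconv D Q e a lD lQ; rewrite ltW // e1 => /(_ isT).
  set y := g (fun b => _) a => yle.
  have := sqr_pos_part_le (g D a - c) (e * (g Q a - g D a)).
  rewrite -/(p a).
  have : (e * (g Q a - g D a)) ^+ 2 <= e ^+ 2.
    rewrite exprMn ler_piMr ?sqr_ge0 //; nra.
  have : Num.max (y - c) 0 ^+ 2 <=
      Num.max (g D a - c + e * (g Q a - g D a)) 0 ^+ 2.
    apply: sqr_pos_part_homo; lra.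
  lra.
rewrite !big_split /= -mulr_sumr sumrB pd sumr_const -/(H D) -mulr_natr -/m.
have -> : d ^+ 4 / m = 2 * e * d ^+ 2 - e ^+ 2 * m by rewrite /e; field; rewrite gt_eqF.
have := mulr_ge0_le0 (ltW e0) pq; have := ler_wpM2l (ltW e0) HD; lra.
Qed.

(** * Elementary inequalities for Riemann sums *)

Lemma weighted_AMGM (R : realFieldType) (k : nat) (a b : R) :
  0 <= a -> 0 <= b ->
  k.+1%:R * (b * a ^+ k) <= b ^+ k.+1 + k%:R * a ^+ k.+1.
Proof.
move=> a0 b0; elim: k => [|k IHk]; first by rewrite !expr0 expr1; lra.
(* Added to [a] times the induction hypothesis, this is the claim. *)
have mono : 0 <= (b ^+ k.+1 - a ^+ k.+1) * (b - a).
  case: (leP a b) => ab.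
    by rewrite mulr_ge0 ?subr_ge0 // ler_pXn2r.
  by rewrite mulr_le0 // ?subr_le0 ?ler_pXn2r // ltW.
have := ler_wpM2l a0 IHk.
move: mono; rewrite -!natr1 !exprS; nra.
Qed.

(** [t * x + (Num.max x t - t) ^+ 2 / 2] is an antiderivative of [Num.max x t]; the last square is
    what the left-endpoint rectangle misses of the integral. *)
Lemma max_square_increment (R : realFieldType) (t x z : R) : x <= z ->
  (z - x) * Num.max x t =
  (t * z + (Num.max z t - t) ^+ 2 / 2) - (t * x + (Num.max x t - t) ^+ 2 / 2)
  - (Num.max z t - Num.max x t) ^+ 2 / 2.
Proof.
move=> xz; case: (leP x t) => ?; case: (leP z t) => ?; try by field.
lra.
Qed.

(** * Weight below a candidate *)

Definition weight_below (R : realFieldType) (C : finType) (lt : rel C)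
  (D : C -> R) (a : C) : R := \sum_(b | lt a b) D b.

Lemma weight_below_ge0 (R : realFieldType) (C : finType) (lt : rel C)
    (D : C -> R) (a : C) : lottery D -> 0 <= weight_below lt D a.
Proof. by case=> D0 _; apply: sumr_ge0. Qed.

Lemma weight_below_le1 (R : realFieldType) (C : finType) (lt : rel C)
    (D : C -> R) (a : C) : lottery D -> weight_below lt D a <= 1.
Proof.
case=> D0 <-; rewrite /weight_below [leRHS](bigID (lt a)) /= lerDl.
exact: sumr_ge0.
Qed.

Lemma weight_below_lt (R : realFieldType) (C : finType) (lt : rel C)
    (D : C -> R) (a b : C) : strict_linear_order lt -> lottery D -> lt a b ->
  weight_below lt D b + D b <= weight_below lt D a.
Proof.
move=> [irr tr _] [D0 _] ab; rewrite /weight_below [leRHS](bigD1 b) //= addrC lerD2r.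
rewrite [leRHS](bigID (lt b)) /=; apply: ler_wpDr; first exact: sumr_ge0.
rewrite le_eqVlt; apply/orP; left; apply/eqP/eq_bigl => c.
have [bc|//] := boolP (lt b c); last by rewrite andbF.
rewrite (tr _ _ _ ab bc) andbT; case: eqVneq => // cb.
by move: bc; rewrite cb (negbTE (irr b)).
Qed.

(** The explicit gap below the integral is uniform in [D], which leaves room for the slack lost in
    the minimax argument. It comes from Cauchy-Schwarz: the jumps [d a] of the maximum sum to
    [1 - t] over [#|C|] candidates. *)
Lemma lottery_max_weight_below (R : realFieldType) (C : finType) (lt : rel C)
    (t : R) (D : C -> R) :
  strict_linear_order lt -> 0 <= t <= 1 -> lottery D ->
  \sum_a D a * Num.max (weight_below lt D a) t <=
  (1 + t ^+ 2) / 2 - (1 - t) ^+ 2 / (2 * #|C|%:R).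
Proof.
move=> ltP /andP[t0 t1] lD; have [D0 D1] := lD.
pose m : R := #|C|%:R.
have m0 : m != 0.
  rewrite pnatr_eq0; apply/eqP => /card0_eq C0; move: D1.
  by rewrite big1 => [/esym/eqP|a _]; rewrite ?oner_eq0 //; have := C0 a; rewrite inE.
pose F x := t * x + (Num.max x t - t) ^+ 2 / 2.
pose d a := Num.max (weight_below lt D a + D a) t - Num.max (weight_below lt D a) t.
have inc a : D a * Num.max (weight_below lt D a) t =
    (F (weight_below lt D a + D a) - F (weight_below lt D a)) - d a ^+ 2 / 2.
  by rewrite -max_square_increment ?lerDl // addrC addKr.
have sumd : \sum_a d a = 1 - t.
  rewrite (telescope_strict_linear_order _ (fun x => Num.max x t) ltP) D1.
  by rewrite (max_l t1) (max_r t0).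
rewrite (eq_bigr _ (fun a _ => inc a)) sumrB.
rewrite telescope_strict_linear_order // D1 /F (max_l t1) (max_r t0).
(* The mean jump; expanding [(d a - l) ^+ 2 >= 0] and summing gives Cauchy-Schwarz. *)
pose l := (1 - t) / m.
have : \sum_a (l * d a - l ^+ 2 / 2) <= \sum_a d a ^+ 2 / 2.
  by apply: ler_sum => a _; have := sqr_ge0 (d a - l); rewrite sqrrB; lra.
rewrite sumrB -mulr_sumr sumd sumr_const -mulr_natr.
have : l * (1 - t) - l ^+ 2 / 2 * m = (1 - t) ^+ 2 / (2 * m).
  by rewrite /l; field.
rewrite /m; lra.
Qed.

(** * Integration of the clamped quantile *)

Definition clamp (R : realFieldType) (t q x : R) : R := Num.min (Num.max x t) q.

(* Up to an additive constant, the integral of [q - clamp t q y] against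
   [d (y ^+ k)] over [0, x]. *)
Definition clamp_potential (R : realFieldType) (k : nat) (t q x : R) : R :=
  q * clamp t q x ^+ k - k%:R / k.+1%:R * clamp t q x ^+ k.+1
  + (q - t) * Num.min x t ^+ k.

(** The integrand [q - clamp t q y] is nonincreasing in [y], so its right-endpoint rectangle lies
    below the integral. *)
Lemma clamp_power_increment (R : realFieldType) (k : nat) (t q x z : R) :
  0 <= t -> t <= q -> 0 <= x -> x <= z ->
  (q - clamp t q z) * (z ^+ k - x ^+ k) <=
  clamp_potential k t q z - clamp_potential k t q x.
Proof.
move=> t0 tq x0 xz.
have z0 := le_trans x0 xz; have q0 := le_trans t0 tq.
set y := clamp t q x; set w := clamp t q z.
have y0 : 0 <= y by rewrite /y /clamp le_min le_max x0 q0.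
have w0 : 0 <= w by rewrite /w /clamp le_min le_max z0 q0.
have wq : w <= q by rewrite /w /clamp ge_min lexx orbT.
have tw : t <= w by rewrite /w /clamp le_min le_max lexx tq orbT.
have /= := weighted_AMGM k y0 w0.
have k0 : 0 < k.+1%:R :> R by rewrite ltr0n.
rewrite -ler_pdivlMl // => amgm.
have hyw : (q - w) * (w ^+ k - y ^+ k) <=
    (q * w ^+ k - k%:R / k.+1%:R * w ^+ k.+1)
    - (q * y ^+ k - k%:R / k.+1%:R * y ^+ k.+1).
  have e : k.+1%:R^-1 * (w ^+ k.+1 + k%:R * y ^+ k.+1) =
     w ^+ k.+1 - k%:R / k.+1%:R * w ^+ k.+1 + k%:R / k.+1%:R * y ^+ k.+1.
    by rewrite -natr1; field; rewrite natr1 gt_eqF.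
  move: amgm; rewrite e [w ^+ k.+1]exprS.
  move: (k%:R / k.+1%:R) (w ^+ k) (y ^+ k) (y ^+ k.+1) => K wk yk yk1; nra.
have hmin : (q - w) * (Num.min z t ^+ k - Num.min x t ^+ k) <=
    (q - t) * (Num.min z t ^+ k - Num.min x t ^+ k).
  apply: ler_wpM2r; last by rewrite lerD2l lerN2.
  rewrite subr_ge0 lerXn2r ?nnegrE ?le_min ?x0 ?z0 ?t0 //.
  by rewrite !ge_min xz lexx orbT.
(* The power increment splits at [t]; when [z] exceeds [q] the factor [q - w] is zero. *)
have -> : (q - w) * (z ^+ k - x ^+ k) =
    (q - w) * (w ^+ k - y ^+ k + (Num.min z t ^+ k - Num.min x t ^+ k)).
  rewrite /w /y /clamp; case: (leP z t) => zt; case: (leP x t) => xt.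
  - by rewrite min_l // ; ring.
  - lra.
  - rewrite (min_l tq); case: (leP z q) => zq; ring.
  - case: (leP z q) => zq; last by ring.
    by rewrite (min_l (le_trans xz zq)); ring.
rewrite /clamp_potential -/y -/w.
rewrite mulrDr; apply: le_trans (lerD hyw hmin) _.
by rewrite le_eqVlt; apply/orP; left; apply/eqP; ring.
Qed.

(** * Independent samples and their shortfall *)

Lemma prob_all_samples (R : realFieldType) (C : finType) (k : nat) (D : C -> R)
    (A : pred C) :
  \sum_(s : {ffun 'I_k -> C}) (\prod_i D (s i)) * [forall i, A (s i)]%:R =
  (\sum_(b | A b) D b) ^+ k.
Proof.
have -> : (\sum_(b | A b) D b) ^+ k = \prod_(i < k) \sum_b D b * (A b)%:R.
  rewrite prodr_const card_ord big_mkcond; congr (_ ^+ _).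
  by apply: eq_bigr => b _; case: (A b); rewrite ?mulr1 ?mulr0.
rewrite bigA_distr_bigA; apply: eq_bigr => s _; rewrite big_split; congr (_ * _).
have [/forallP sA|] := boolP [forall i, A (s i)].
  by rewrite big1 // => i _; rewrite sA.
by rewrite negb_forall => /existsP[i /negbTE sA]; rewrite (bigD1 i) //= sA mul0r.
Qed.

(* The difference of indicators is that of [b] being the best element of the
   sample [s]; so this is [q - clamp t q x], where [x] is the total weight of
   the elements that are no better than the best element of [s]. *)
Definition shortfall (R : realFieldType) (C : finType) (k : nat) (lt : rel C)
    (D : C -> R) (t q : R) (s : {ffun 'I_k -> C}) : R :=
  \sum_b (q - clamp t q (weight_below lt D b + D b)) *
    ([forall i, (s i == b) || lt b (s i)]%:R - [forall i, lt b (s i)]%:R).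

Section Shortfall.
Variables (R : realFieldType) (C : finType) (k : nat) (lt : rel C).
Variables (D : C -> R) (t q : R).
Hypotheses (ltP : strict_linear_order lt) (lD : lottery D).

Lemma shortfall_term_ge0 (s : {ffun 'I_k -> C}) b :
  0 <= (q - clamp t q (weight_below lt D b + D b)) *
    ([forall i, (s i == b) || lt b (s i)]%:R - [forall i, lt b (s i)]%:R).
Proof.
apply: mulr_ge0; first by rewrite subr_ge0 /clamp ge_min lexx orbT.
rewrite subr_ge0 ler_nat; case: (boolP [forall i, lt b (s i)]) => // /forallP sb.
by rewrite lt0b; apply/forallP => i; rewrite sb orbT.
Qed.

Lemma shortfall_ge0 (s : {ffun 'I_k -> C}) : 0 <= shortfall lt D t q s.
Proof. by apply: sumr_ge0 => b _; apply: shortfall_term_ge0. Qed.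

(** For the best sample [b] the indicator difference is 1, and [a] being preferred to [b] puts
    [weight_below lt D b + D b] at or below [weight_below lt D a]. *)
Lemma shortfall_dominated (s : {ffun 'I_k -> C}) a :
  (0 < k)%N -> (forall i, lt a (s i)) ->
  q - Num.max (weight_below lt D a) t <= shortfall lt D t q s.
Proof.
move=> k0 sa; pose X := [set s i | i : 'I_k].
have sX i : s i \in X by apply: imset_f.
have [b bX btop] := strict_linear_order_top ltP (sX (Ordinal k0)).
have [i _ bi] := imsetP bX; have [irr _ _] := ltP.
rewrite /shortfall (bigD1 b) //=; apply: ler_wpDr.
  by apply: sumr_ge0 => c _; apply: shortfall_term_ge0.
have -> : [forall i, (s i == b) || lt b (s i)].
  by apply/forallP => j; case: eqVneq => //= ?; apply: btop.
have -> : [forall i, lt b (s i)] = false.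
  by apply/negbTE/negP => /forallP/(_ i); rewrite -bi (negbTE (irr b)).
rewrite subr0 mulr1 lerD2l lerN2 /clamp ge_min ge_max !le_max lexx orbT andbT.
by rewrite weight_below_lt // bi.
Qed.

(** The best sample is [b] with probability the increment of [y ^+ k] over the interval of [b], so
    the mean is a lower sum for the integral of [q - clamp t q y] against [d (y ^+ k)]. By parts,
    this is the integral of [y ^+ k] from [t] to [q]. *)
Lemma expected_shortfall :
  (0 < k)%N -> 0 <= t -> t <= q -> q <= 1 ->
  \sum_(s : {ffun 'I_k -> C}) (\prod_i D (s i)) * shortfall lt D t q s <=
  (q ^+ k.+1 - t ^+ k.+1) / k.+1%:R.
Proof.
move=> k0 t0 tq q1; have [D0 D1] := lD; have [irr _ _] := ltP.
have t1 := le_trans tq q1.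
have -> : \sum_(s : {ffun 'I_k -> C}) (\prod_i D (s i)) * shortfall lt D t q s =
    \sum_b (q - clamp t q (weight_below lt D b + D b)) *
      ((weight_below lt D b + D b) ^+ k - weight_below lt D b ^+ k).
  under eq_bigr do rewrite mulr_sumr.
  rewrite exchange_big /=; apply: eq_bigr => b _.
  under eq_bigr do rewrite mulrCA.
  rewrite -mulr_sumr; congr (_ * _).
  under eq_bigr do rewrite mulrBr.
  rewrite sumrB (prob_all_samples k D (lt b)).
  rewrite (prob_all_samples k D (fun c => (c == b) || lt b c)).
  rewrite (bigD1 b) ?eqxx //= addrC; congr ((_ + _) ^+ _ - _).
  apply: eq_bigl => c; case: eqVneq => [->|] //=; last by rewrite andbT.
  by rewrite (negbTE (irr b)).
pose F := clamp_potential k t q.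
apply: (@le_trans _ _ (\sum_b (F (weight_below lt D b + D b) - F (weight_below lt D b)))).
  apply: ler_sum => b _; apply: clamp_power_increment => //.
    exact: weight_below_ge0.
  by rewrite lerDl.
rewrite telescope_strict_linear_order // D1 /F /clamp_potential /clamp (max_l t1) (max_r t0).
rewrite (min_r q1) (min_l tq) (min_r t1) (min_l t0) expr0n gtn_eqF //.
rewrite mulr0 addr0 le_eqVlt; apply/orP; left; apply/eqP.
by rewrite !exprS -natr1; field; rewrite natr1 pnatr_eq0.
Qed.

End Shortfall.

(** * From lotteries to committees *)

Lemma superset_of_card (C : finType) (A : {set C}) (k : nat) :
  (#|A| <= k <= #|C|)%N -> exists2 S : {set C}, A \subset S & #|S| = k.
Proof.
elim: k => [|k IHk] /andP[Ak kC]; first by exists A => //; apply/eqP; rewrite -leqn0.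
move: Ak; rewrite leq_eqVlt => /predU1P[|]; first by exists A.
rewrite ltnS => Ak; have [|S AS cS] := IHk; first by rewrite Ak ltnW.
have [x xS] : exists x, x \in ~: S.
  by apply/card_gt0P; rewrite cardsCs finset.setCK cS subn_gt0.
exists (x |: S); first by rewrite (fintype.subset_trans AS) // finset.subsetU1.
by rewrite cardsU1 cS; move: xS; rewrite inE => ->.
Qed.

Lemma max_mix_le (R : realFieldType) (t x y e : R) : 0 <= e <= 1 ->
  Num.max ((1 - e) * x + e * y) t <= (1 - e) * Num.max x t + e * Num.max y t.
Proof.
move=> /andP[e0 e1]; have xm : x <= Num.max x t by rewrite le_max lexx.
have tx : t <= Num.max x t by rewrite le_max lexx orbT.
have ym : y <= Num.max y t by rewrite le_max lexx.
have ty : t <= Num.max y t by rewrite le_max lexx orbT.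
by rewrite ge_max; apply/andP; split; nra.
Qed.

Lemma exists_balanced_lottery (R : archiRealFieldType) (V C : finType)
    (pref : V -> rel C) (t : R) :
  election pref -> (0 < #|V|)%N -> (0 < #|C|)%N -> 0 <= t -> t < 1 ->
  exists c (D : C -> R), [/\ c < (1 + t ^+ 2) / 2, lottery D &
    forall a, \sum_v Num.max (weight_below (pref v) D a) t <= #|V|%:R * c].
Proof.
move=> prefP V0 C0 t0 t1; have [c0 _] := card_gt0P C0.
have n0 : 0 < #|V|%:R :> R by rewrite ltr0n.
pose g (D : C -> R) a := (\sum_v Num.max (weight_below (pref v) D a) t) / #|V|%:R.
pose d := (1 - t) ^+ 2 / (2 * #|C|%:R).
have d0 : 0 < d.
  apply: divr_gt0; last by rewrite mulr_gt0 ?ltr0n.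
  by rewrite exprn_gt0 // subr_gt0.
(* Half of the gap [d] is spent on the minimax; the other half keeps the final bound strict. *)
pose c := (1 + t ^+ 2) / 2 - d.
have [||||D lD gD] := @convex_minimax_diag R C c0 g c (c + d / 2).
- move=> D a lD; apply/andP; split.
    rewrite divr_ge0 ?ler0n //; apply: sumr_ge0 => v _.
    by rewrite le_max t0 orbT.
  rewrite ler_pdivrMr // mul1r -sum1_card natr_sum; apply: ler_sum => v _.
  by rewrite ge_max weight_below_le1 // ltW.
- move=> D Q e a lD lQ e01; rewrite /g !mulrA -mulrDl ler_pM2r ?invr_gt0 //.
  rewrite !mulr_sumr -big_split /=; apply: ler_sum => v _.
  apply: le_trans (max_mix_le _ _ _ e01).
  by rewrite /weight_below big_split /= -!mulr_sumr.
- move=> Q lQ; under eq_bigr do rewrite mulrA mulr_sumr.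
  rewrite -mulr_suml exchange_big /= ler_pdivrMr // mulrC mulr_natl -sumr_const.
  apply: ler_sum => v _; apply: lottery_max_weight_below => //.
  by rewrite t0 ltW.
- lra.
exists (c + d / 2), D; split=> // [|a]; first by rewrite /c; lra.
by rewrite -ler_pdivrMl // mulrC ltW // gD.
Qed.

(** Stated with a root [q] in place of real powers, so that the case [t = 1] of the theorem can be
    obtained from [t = 0], [q = 1]. *)
Lemma undominated_committee_of_root (R : realType) (k : nat) (t q : R) :
  (0 < k)%N -> 0 <= t -> t < 1 -> 0 <= q -> q ^+ k = t ^+ k - t + 1 ->
  (1 - t ^+ 2) / 2 <= k%:R / k.+1%:R * (q ^+ k.+1 - t ^+ k.+1) ->
  forall (V C : finType) (pref : V -> rel C),
    election pref -> (k <= #|C|)%N ->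
    exists S : {set C}, #|S| = k /\ @undominated R V C pref (t ^+ k - t + 1) S.
Proof.
move=> k0 t0 t1 q0 qk hyp V C pref prefP kC.
apply: contrapT => noS.
have {}noS (S : {set C}) : #|S| = k -> exists a, q ^+ k <= dom_frac R pref a S.
  move=> cS; apply: contrapT => na; apply: noS; exists S; split=> // a.
  by rewrite -qk ltNge; apply/negP => ?; apply: na; exists a.
have tk0 : 0 <= t ^+ k by rewrite exprn_ge0.
(* Without voters [dom_frac] is 0, as division by 0 gives 0, while [q ^+ k] is positive because
   [t < 1]. *)
have V0 : (0 < #|V|)%N.
  rewrite lt0n; apply/eqP => cV.
  have [|S _ cS] := @superset_of_card C finset.set0 k; first by rewrite cards0.
  have [a] := noS S cS; rewrite /dom_frac cV invr0 mulr0 qk; lra.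
have tk : t ^+ k <= t by rewrite ler_iXnr // ltW.
have tq : t <= q by rewrite -(ler_pXn2r k0) ?nnegrE // qk; lra.
have q1 : q <= 1 by rewrite -(ler_pXn2r k0) ?nnegrE // qk expr1n; lra.
have [c [D [cc lD gD]]] := exists_balanced_lottery prefP V0 (leq_trans k0 kC) t0 t1.
have [D0 D1] := lD.
pose n : R := #|V|%:R.
have n0 : 0 < n by rewrite ltr0n.
have lower (s : {ffun 'I_k -> C}) :
    n * (t + q ^+ k * (q - t) - c) <= \sum_v shortfall (pref v) D t q s.
  (* Samples may repeat, so they are completed to [k] candidates; whoever is preferred to all of [S]
     is preferred to all samples. *)
  have [|S /fintype.subsetP sS cS] := @superset_of_card C [set s i | i : 'I_k] k.
    by rewrite kC andbT (leq_trans (leq_imset_card _ _)) // card_ord.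
  have [a] := noS S cS; rewrite /dom_frac ler_pdivlMr // -/n.
  set A := [set v | _] => nA.
  have : \sum_v (t + (v \in A)%:R * (q - t) - shortfall (pref v) D t q s) <=
      \sum_v Num.max (weight_below (pref v) D a) t.
    apply: ler_sum => v _; rewrite inE.
    case: (boolP (prefers_to_all pref v a S)) => [/forallP aS|_].
      have : q - Num.max (weight_below (pref v) D a) t <= shortfall (pref v) D t q s.
        apply: shortfall_dominated => // i.
        by have /implyP := aS (s i); apply; apply/sS/imset_f.
      rewrite mul1r; lra.
    have tm : t <= Num.max (weight_below (pref v) D a) t by rewrite le_max lexx orbT.
    have := shortfall_ge0 (pref v) D t q s; rewrite mul0r; lra.
  rewrite sumrB big_split /= -mulr_suml -natr_sum -big_mkcond sum1_card.
  rewrite sumr_const -mulr_natr -/n => h.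
  have := gD a; rewrite -/n.
  have : q ^+ k * n * (q - t) <= #|A|%:R * (q - t) by rewrite ler_wpM2r ?subr_ge0.
  lra.
pose w (s : {ffun 'I_k -> C}) := \prod_i D (s i).
have w0 s : 0 <= w s by apply: prodr_ge0.
have w1 : \sum_s w s = 1.
  have := prob_all_samples k D predT; rewrite D1 expr1n => <-.
  apply: eq_bigr => s _; suff -> : [forall i, predT (s i)] by rewrite mulr1.
  exact/forallP.
have : n * (t + q ^+ k * (q - t) - c) <= n * ((q ^+ k.+1 - t ^+ k.+1) / k.+1%:R).
  apply: (@le_trans _ _ (\sum_s w s * \sum_v shortfall (pref v) D t q s)).
    rewrite -[leLHS]mul1r -[X in X * _]w1 mulr_suml.
    by apply: ler_sum => s _; rewrite ler_wpM2l.
  under eq_bigr do rewrite mulr_sumr.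
  rewrite exchange_big /= mulr_natl -sumr_const; apply: ler_sum => v _.
  exact: expected_shortfall.
rewrite ler_pM2l //.
(* The value of [q ^+ k] makes the terms linear in [t] cancel, leaving [k / (k + 1) * (q ^+ k.+1 - t
   ^+ k.+1) <= c - t ^+ 2], which is below [(1 - t ^+ 2) / 2]. *)
have tqk : t * q ^+ k = t ^+ k.+1 - t ^+ 2 + t by rewrite qk exprS; ring.
have -> : q ^+ k * (q - t) = q ^+ k.+1 - t * q ^+ k by rewrite exprS; ring.
rewrite tqk; move: hyp.
have -> : k%:R / k.+1%:R * (q ^+ k.+1 - t ^+ k.+1) =
    (q ^+ k.+1 - t ^+ k.+1) - (q ^+ k.+1 - t ^+ k.+1) / k.+1%:R.
  by rewrite -natr1; field; rewrite natr1 pnatr_eq0.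
move: ((q ^+ _ - _) / _) => J; lra.
Qed.

Theorem theorem5 (R : realType) (k : nat) (t : R) :
  (1 <= k)%N -> 0 <= t <= 1 ->
  (k%:R / (k.+1)%:R) *
    ((t ^+ k - t + 1) `^ ((k.+1)%:R / k%:R) - t ^+ k.+1) >= (1 - t ^+ 2) / 2 ->
  forall (V C : finType) (pref : V -> rel C),
    election pref -> (k <= #|C|)%N ->
    exists S : {set C}, #|S| = k /\ @undominated R V C pref (t ^+ k - t + 1) S.
Proof.
move=> k0 /andP[t0 t1] hyp.
have [t_eq1|t_neq1] := eqVneq t 1.
  have expr0k : 0 ^+ k = 0 :> R by rewrite expr0n gtn_eqF.
  (* For t = 1 the threshold is 1, which is also the threshold for t = 0. *)
  have -> : t ^+ k - t + 1 = 0 ^+ k - 0 + 1.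
    by rewrite t_eq1 expr1n expr0k; ring.
  apply: (@undominated_committee_of_root R k 0 1) => //.
    by rewrite expr1n expr0k; ring.
  rewrite expr1n !expr0n /= !subr0 mulr1 ler_pdivlMr ?ltr0n //.
  have : 1 <= k%:R :> R by rewrite ler1n.
  by rewrite -[k.+1%:R]natr1; lra.
have k_neq0 : k%:R != 0 :> R by rewrite pnatr_eq0 -lt0n.
have a0 : 0 <= t ^+ k - t + 1 by have := exprn_ge0 k t0; lra.
apply: (@undominated_committee_of_root R k t ((t ^+ k - t + 1) `^ k%:R^-1)) => //.
- by rewrite lt_neqAle t_neq1.
- exact: powR_ge0.
- by rewrite -powR_mulrn ?powR_ge0 // -powRrM mulVf // powRr1.
- by rewrite -[(_ `^ _) ^+ _]powR_mulrn ?powR_ge0 // -powRrM [_^-1 * _]mulrC.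
Qed.
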